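(* Let $(A,\cdot,\alpha)$ be a Hom-pre-Malcev algebra. Then the commutator $[x,y]=x\cdot y-y\cdot x$ ($x,y\in A$) defines a Hom-Malcev algebra structure $(A,[-,-],\alpha)$ on $A$.
   Context: All vector spaces are over a field $\mathbb K$ of characteristic $0$. A Hom-pre-Malcev algebra $(A,\cdot,\alpha)$ is a vector space $A$ with a bilinear product $\cdot$ and a linear map $\alpha:A\to A$ such that for all $x,y,z,t\in A$, writing $[x,y]=x\cdot y-y\cdot x$, $$\alpha([y,z])\cdot\alpha(x\cdot t)+[[x,y],\alpha(z)]\cdot\alpha^2(t)+\alpha^2(y)\cdot([x,z]\cdot\alpha(t))-\alpha^2(x)\cdot(\alpha(y)\cdot(z\cdot t))+\alpha^2(z)\cdot(\alpha(x)\cdot(y\cdot t))=0.$$ A Hom-Malcev algebra $(A,[-,-],\alpha)$ is a vector space $A$ with an anti-symmetric bilinear bracket and a linear map $\alpha:A\to A$ such that for all $x,y,z,t\in A$, $$[\alpha([x,z]),\alpha([y,t])]=[[[x,y],\alpha(z)],\alpha^2(t)]+[[[y,z],\alpha(t)],\alpha^2(x)]+[[[z,t],\alpha(x)],\alpha^2(y)]+[[[t,x],\alpha(y)],\alpha^2(z)].$$ *)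

(* Defs.v *)
From mathcomp Require Import all_boot all_order all_algebra.

Set Implicit Arguments.
Unset Strict Implicit.
Unset Printing Implicit Defensive.

Import GRing.Theory.
Local Open Scope ring_scope.

Definition commutator (A : zmodType) (mul : A -> A -> A) (x y : A) : A :=
  mul x y - mul y x.

(* The twisting map is not required to be multiplicative. *)
Record hom_pre_Malcev (K : fieldType) (A : lmodType K)
    (mul : A -> A -> A) (alpha : A -> A) : Prop := HomPreMalcev {
  hom_pre_Malcev_bilinear : bilinear_for *:%R *:%R mul;
  hom_pre_Malcev_linear : linear alpha;
  hom_pre_Malcev_identity : forall x y z t : A,
    let br := commutator mul in
      mul (alpha (br y z)) (alpha (mul x t))
    + mul (br (br x y) (alpha z)) (alpha (alpha t))
    + mul (alpha (alpha y)) (mul (br x z) (alpha t))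
    - mul (alpha (alpha x)) (mul (alpha y) (mul z t))
    + mul (alpha (alpha z)) (mul (alpha x) (mul y t)) = 0
}.

Record hom_Malcev (K : fieldType) (A : lmodType K)
    (br : A -> A -> A) (alpha : A -> A) : Prop := HomMalcev {
  hom_Malcev_bilinear : bilinear_for *:%R *:%R br;
  hom_Malcev_linear : linear alpha;
  hom_Malcev_antisymmetric : forall x y : A, br x y = - br y x;
  hom_Malcev_identity : forall x y z t : A,
    br (alpha (br x z)) (alpha (br y t)) =
      br (br (br x y) (alpha z)) (alpha (alpha t))
    + br (br (br y z) (alpha t)) (alpha (alpha x))
    + br (br (br z t) (alpha x)) (alpha (alpha y))
    + br (br (br t x) (alpha y)) (alpha (alpha z))
}.

(* Main.v *)
Require Import Defs.
From mathcomp Require Import all_boot all_order all_algebra.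
Import GRing.Theory.
Local Open Scope ring_scope.

(** Let P(x,y,z,t) be the left-hand side of the Hom-pre-Malcev identity, and
    let the cyclic sum of an expression in x, y, z, t be the sum of its images
    under the four rotations generated by x -> y -> z -> t -> x.  The proof
    establishes that, for the commutator bracket,

      cyclic sum of <<<x,y>,αz>,α²t>  -  <α<x,z>,α<y,t>>
        =  - cyclic sum of P(y,x,z,t),

    where <a,b> stands for a·b - b·a.  The right-hand side vanishes, and the
    left-hand side vanishes exactly when the Hom-Malcev identity holds.

    The five terms of P(y,x,z,t) are, up to sign, the functions [twist_term],
    [left_term], [comm_term], [outer_term] and [inner_term].  In the cyclic sum,
    - the four terms α<x,z>·α(y·t) pair up into the single commutator
      <α<x,z>,α<y,t>> ([cycsum_twist_term]);
    - the other terms are sorted by the variable that carries α².  In the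
      expansion of <<<x,y>,αz>,α²t>, the product with α²t on the right is
      - [left_term], while the products with α²t on the left come from three
      different rotations of P(y,x,z,t) ([triple_commutatorE]).
    Rotating a summand does not change its cyclic sum ([cycsum_rot]), so it does
    not matter that the latter come from different rotations. *)

Section CyclicSum.

Context {A : zmodType}.
Implicit Types f g : A -> A -> A -> A -> A.

Definition cycsum f (x y z t : A) : A :=
  f x y z t + f y z t x + f z t x y + f t x y z.

Lemma eq_cycsum f g x y z t :
  (forall a b c d, f a b c d = g a b c d) -> cycsum f x y z t = cycsum g x y z t.
Proof. by move=> eq_fg; rewrite /cycsum !eq_fg. Qed.

Lemma cycsumD f g x y z t :
  cycsum (fun a b c d => f a b c d + g a b c d) x y z t =
  cycsum f x y z t + cycsum g x y z t.
Proof.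
rewrite /cycsum [RHS]addrACA; congr (_ + _).
by rewrite [RHS]addrACA; congr (_ + _); rewrite addrACA.
Qed.

Lemma cycsumN f x y z t :
  cycsum (fun a b c d => - f a b c d) x y z t = - cycsum f x y z t.
Proof. by rewrite /cycsum !opprD. Qed.

Lemma cycsum_rot f x y z t :
  cycsum (fun a b c d => f b c d a) x y z t = cycsum f x y z t.
Proof. by rewrite /cycsum addrC !addrA. Qed.

End CyclicSum.

Section LinearMaps.

Context {K : fieldType} {A : lmodType K}.

Lemma linear_sub (f : A -> A) : linear f -> {morph f : u v / u - v}.
Proof.
by move=> lin_f u v; rewrite [u - v]addrC -[- v]scaleN1r lin_f scaleN1r addrC.
Qed.

Lemma linear_opp (f : A -> A) : linear f -> {morph f : u / - u}.
Proof.
move=> lin_f u.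
have f0 : f 0 = 0 by rewrite -[X in f X](subrr 0) linear_sub // subrr.
by rewrite -[- u]sub0r linear_sub // f0 sub0r.
Qed.

End LinearMaps.

Lemma commutator_anti (A : zmodType) (mul : A -> A -> A) x y :
  commutator mul x y = - commutator mul y x.
Proof. by rewrite /commutator opprB. Qed.

Lemma commutator_bilinear (K : fieldType) (A : lmodType K)
    (mul : A -> A -> A) :
  bilinear_for *:%R *:%R mul -> bilinear_for *:%R *:%R (commutator mul).
Proof.
case=> linl linr; split=> u k v w; rewrite /commutator /=;
  by rewrite (linl u k v w) (linr u k v w) scalerBr opprD addrACA.
Qed.

Section HomMalcevIdentity.

Context {K : fieldType} {A : lmodType K}.
Context (mul : A -> A -> A) (alpha : A -> A).
Context (hA : hom_pre_Malcev mul alpha).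

Local Notation "x · y" := (mul x y) (at level 40, left associativity).
Local Notation br := (commutator mul).
Local Notation alpha2 x := (alpha (alpha x)).

Let lin_mull u : linear (mul^~ u) := (hom_pre_Malcev_bilinear hA).1 u.
Let lin_mulr u : linear (mul u) := (hom_pre_Malcev_bilinear hA).2 u.
Let lin_alpha : linear alpha := hom_pre_Malcev_linear hA.

Let mulBr u v w : w · (u - v) = w · u - w · v.
Proof. exact: (linear_sub (mul w) (lin_mulr w)). Qed.
Let mulNl u w : (- u) · w = - (u · w).
Proof. exact: (linear_opp (mul^~ w) (lin_mull w)). Qed.
Let mulNr u w : w · (- u) = - (w · u).
Proof. exact: (linear_opp (mul w) (lin_mulr w)). Qed.
Let alphaB u v : alpha (u - v) = alpha u - alpha v.
Proof. exact: linear_sub. Qed.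
Let alphaN u : alpha (- u) = - alpha u.
Proof. exact: linear_opp. Qed.

Definition twist_term x y z t := alpha (br x z) · alpha (y · t).
Definition left_term x y z t := br (br y x) (alpha z) · alpha2 t.
Definition comm_term x y z t := alpha2 x · (br y z · alpha t).
Definition outer_term x y z t := alpha2 y · (alpha x · (z · t)).
Definition inner_term x y z t := alpha2 z · (alpha y · (x · t)).

(** Rotating twice exchanges x with z and y with t, which negates the factor
    [br x z] and turns [y · t] into [t · y].  So each of the two pairs of opposite
    rotations gives one of the two products of the bracket. *)
Lemma cycsum_twist_term x y z t :
  cycsum twist_term x y z t = br (alpha (br x z)) (alpha (br y t)).
Proof.
have mul_alpha_br a u v : a · alpha (br u v) = a · alpha (u · v) - a · alpha (v · u).
  by rewrite alphaB mulBr.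
rewrite /cycsum /twist_term [br z x]commutator_anti [br t y]commutator_anti.
rewrite !alphaN !mulNl [RHS]/commutator !mul_alpha_br opprB.
by rewrite [RHS]addrACA [RHS]addrA.
Qed.

(** The permuted arguments are the rotations of (x,y,z,t) in which the term
    starts with [alpha2 t]; the three terms expand the product of [alpha2 t] with
    [br (br x y) (alpha z)]. *)
Lemma triple_commutatorE x y z t :
  br (br (br x y) (alpha z)) (alpha2 t) =
  - left_term x y z t
  - (comm_term t x y z - outer_term z t x y + inner_term y z t x).
Proof.
rewrite /left_term /comm_term /outer_term /inner_term.
have brE a b : br a b = a · b - b · a by [].
have brNl a b : br (- a) b = - br a b.
  by rewrite [RHS]opprB /commutator mulNl mulNr opprK addrC.
rewrite [br y x]commutator_anti brNl mulNl opprK.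
rewrite [LHS]brE; congr (_ - _).
rewrite [br (br x y) _]brE mulBr -addrA; congr (_ + _).
by rewrite [br x y]brE !mulBr opprB addrC.
Qed.

Lemma commutator_hom_Malcev_identity x y z t :
  br (alpha (br x z)) (alpha (br y t)) =
  cycsum (fun a b c d => br (br (br a b) (alpha c)) (alpha2 d)) x y z t.
Proof.
(* These bring the terms collected by [triple_commutatorE] back to the rotation
   in which they occur in a single instance of the pre-Malcev identity. *)
have rotC : cycsum (fun a b c d => comm_term d a b c) x y z t =
    cycsum comm_term x y z t.
  by rewrite -cycsum_rot.
have rotO : cycsum (fun a b c d => outer_term c d a b) x y z t =
    cycsum outer_term x y z t.
  by rewrite -cycsum_rot -(cycsum_rot (fun a b c d => outer_term d a b c)).
have rotI : cycsum (fun a b c d => inner_term b c d a) x y z t =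
    cycsum inner_term x y z t.
  exact: cycsum_rot.
have sumP : cycsum (fun a b c d => twist_term a b c d + (left_term a b c d
    + (comm_term a b c d - outer_term a b c d + inner_term a b c d)))
    x y z t = 0.
  rewrite (eq_cycsum _ (fun _ _ _ _ => 0)) => [|a b c d].
    by rewrite /cycsum !addr0.
  (* The first two arguments are exchanged: this is the instance P(b,a,c,d). *)
  by rewrite !addrA; exact: (hom_pre_Malcev_identity hA b a c d).
rewrite (eq_cycsum _ _ _ _ _ _ triple_commutatorE).
rewrite !(cycsumD, cycsumN) rotC rotO rotI -opprD.
rewrite !(cycsumD, cycsumN) cycsum_twist_term in sumP.
by apply/eqP; rewrite -addr_eq0 sumP.
Qed.

End HomMalcevIdentity.

Theorem proposition3p2 (K : fieldType) (charK0 : [pchar K] =i pred0)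
    (A : lmodType K) (mul : A -> A -> A) (alpha : A -> A)
    (hA : hom_pre_Malcev mul alpha) :
  hom_Malcev (commutator mul) alpha.
Proof.
split.
- exact: commutator_bilinear (hom_pre_Malcev_bilinear hA).
- exact: hom_pre_Malcev_linear hA.
- exact: commutator_anti.
- exact: commutator_hom_Malcev_identity hA.
Qed.
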